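(* Let $\mathcal{R}:\mathbb{X}\to\mathbb{Y}$ be an $\varepsilon_0$-DP local randomizer and let $\mathcal{M}_S=\mathcal{S}\circ\mathcal{R}^n$ be the shuffling of $\mathcal{R}$. Let $\varepsilon\ge 0$, and let $X^0=(x_1^0,x_2,\dots,x_n)$ and $X^1=(x_1^1,x_2,\dots,x_n)$ be neighboring datasets in $\mathbb{X}^n$ with $x_1^0\neq x_1^1$. Let a general clone decomposition of $\mathcal{R}$ (with respect to $x_1^0,x_1^1,x_2,\dots,x_n$) be given, and let $(P_0^{\mathsf{GC}},P_1^{\mathsf{GC}})$ be its reduction pair. Then $$D_{e^\varepsilon}\big(\mathcal{M}_S(X^0)\,\|\,\mathcal{M}_S(X^1)\big)\le D_{e^\varepsilon}\big(P_0^{\mathsf{GC}}\,\|\,P_1^{\mathsf{GC}}\big).$$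
   Context: A local randomizer $\mathcal{R}:\mathbb{X}\to\mathbb{Y}$ is a randomized map; $\mathcal{R}(x)$ also denotes the output distribution on input $x$. Hockey-stick divergence: for distributions $P,Q$ on the same space and $\alpha\ge 0$, $D_\alpha(P\|Q)=\int\max\{0,P(x)-\alpha Q(x)\}\,dx$, where $P(\cdot),Q(\cdot)$ are densities with respect to a common reference measure (a sum in the discrete case). $\mathcal{R}$ is $\varepsilon_0$-DP (a local $\varepsilon_0$-DP randomizer) if $D_{e^{\varepsilon_0}}(\mathcal{R}(x)\|\mathcal{R}(x'))=0$ for all $x,x'\in\mathbb{X}$. Shuffling: $\mathcal{M}_S(x_1,\dots,x_n)=\mathcal{S}(\mathcal{R}(x_1),\dots,\mathcal{R}(x_n))$, where the $\mathcal{R}(x_i)$ are sampled independently and $\mathcal{S}$ applies an independent uniformly random permutation to its $n$ inputs. General clone decomposition: an integer $k\ge1$, probability distributions $Q_1^1,\dots,Q_1^k$ and $Q_2,\dots,Q_n$ on $\mathbb{Y}$, and non-negative coefficients $a_j,b_j,c_j$ ($1\le j\le k$) and $\beta$ with $\sum_j a_j=1$, $\sum_j b_j=1$, $\beta+\sum_j c_j=1$, such that $$\mathcal{R}(x_1^0)=\sum_{j=1}^k a_jQ_1^j,\qquad \mathcal{R}(x_1^1)=\sum_{j=1}^k b_jQ_1^j,\qquad \mathcal{R}(x_i)=\sum_{j=1}^k c_jQ_1^j+\beta Q_i\quad\text{for all } i\in\{2,\dots,n\}.$$ Reduction pair: let $A_0,A_1,A_2$ be distributions on $\{1,\dots,k+1\}$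 with $\Pr[A_0=j]=a_j$, $\Pr[A_1=j]=b_j$, $\Pr[A_2=j]=c_j$ for $j\le k$, and $\Pr[A_0=k+1]=\Pr[A_1=k+1]=0$, $\Pr[A_2=k+1]=\beta$. For $a\in\{0,1\}$, $P_a^{\mathsf{GC}}$ is the distribution of the histogram $(n_1,\dots,n_{k+1})$ (numbers of occurrences of each index) of $n$ independent samples, one drawn from $A_a$ and $n-1$ drawn from $A_2$. *)

(* Defs.v *)
From HB Require Import structures.
From mathcomp Require Import all_boot all_order all_algebra perm.
From mathcomp Require Import all_classical all_reals all_analysis.
From mathcomp Require Import measurable_realfun.

Set Implicit Arguments.
Unset Strict Implicit.
Unset Printing Implicit Defensive.

Import Order.TTheory GRing.Theory Num.Theory.
Import numFieldNormedType.Exports.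

Local Open Scope classical_set_scope.
Local Open Scope ring_scope.

Section hockey_stick.
Context d (T : measurableType d) (R : realType).
Local Open Scope ereal_scope.
Implicit Types P Q : probability T R.

(* P + Q is the common reference measure; [hockey_stick_densities] below shows
   that any other reference measure and densities give the same divergence. *)
Definition reference P Q : set T -> \bar R := measure_add P Q.

HB.instance Definition _ P Q := Measure.on (reference P Q).

Let reference_fin P Q : fin_num_fun (reference P Q).
Proof.
by move=> A mA; rewrite /reference measure_addE fin_numD !fin_num_measure.
Qed.

HB.instance Definition _ P Q :=
  Measure_isFinite.Build _ T R (reference P Q) (reference_fin P Q).

Definition density P (mu : {sigma_finite_measure set T -> \bar R}) :
  T -> \bar R := Radon_Nikodym (charge_of_finite_measure P) mu.

Definition hockey_stick (alpha : R) P Q : \bar R :=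
  \int[reference P Q]_x
    maxe 0 (density P (reference P Q) x - alpha%:E * density Q (reference P Q) x).

End hockey_stick.

Section hockey_stick_densities.
Context d (T : measurableType d) (R : realType).
Local Open Scope ereal_scope.

Let density_unique (P : probability T R)
    (mu : {sigma_finite_measure set T -> \bar R}) (p : T -> R) :
  measurable_fun setT p -> (forall x, (0 <= p x)%R) ->
  (forall A, measurable A -> P A = \int[mu]_(x in A) (p x)%:E) ->
  P `<< mu /\ ae_eq mu setT (density P mu) (EFin \o p).
Proof.
move=> mp p0 Pp.
have mp' : measurable_fun setT (fun x => (p x)%:E) by exact/measurable_EFinP.
have Pmu : P `<< mu.
  apply/null_content_dominatesP => A mA muA.
  by rewrite Pp//; apply: null_set_integral => //; exact: measurable_funTS.
split => //; apply: integral_ae_eq => //.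
- exact: Radon_Nikodym_integrable.
- by move=> E _ mE; rewrite -Radon_Nikodym_integral// -Pp.
Qed.

Lemma hockey_stick_densities (P Q : probability T R) (alpha : R)
    (mu : {sigma_finite_measure set T -> \bar R}) (p q : T -> R) :
  measurable_fun setT p -> (forall x, (0 <= p x)%R) ->
  measurable_fun setT q -> (forall x, (0 <= q x)%R) ->
  (forall A, measurable A -> P A = \int[mu]_(x in A) (p x)%:E) ->
  (forall A, measurable A -> Q A = \int[mu]_(x in A) (q x)%:E) ->
  hockey_stick alpha P Q = \int[mu]_x maxe 0 ((p x)%:E - alpha%:E * (q x)%:E).
Proof.
move=> mp p0 mq q0 Pp Qq.
have [Pmu aep] := density_unique mp p0 Pp.
have [Qmu aeq] := density_unique mq q0 Qq.
pose nu : {finite_measure set T -> \bar R} := reference P Q.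
have nuE A : nu A = P A + Q A by rewrite -measure_addE.
have Pnu : charge_of_finite_measure P `<< nu.
  apply/null_content_dominatesP => A mA A0.
  have /eqP : P A + Q A = 0 by rewrite -nuE; exact: A0.
  by rewrite padde_eq0// => /andP[/eqP].
have Qnu : charge_of_finite_measure Q `<< nu.
  apply/null_content_dominatesP => A mA A0.
  have /eqP : P A + Q A = 0 by rewrite -nuE; exact: A0.
  by rewrite padde_eq0// => /andP[_ /eqP].
have numu : nu `<< mu.
  apply/null_content_dominatesP => A mA A0.
  transitivity (P A + Q A); first exact: nuE.
  move/null_content_dominatesP : Pmu => /(_ _ mA A0) ->.
  by move/null_content_dominatesP : Qmu => /(_ _ mA A0) ->; rewrite adde0.
pose f := density P nu; pose g := density Q nu.
pose F x := maxe 0 (f x - alpha%:E * g x).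
have intf : nu.-integrable setT f by exact: Radon_Nikodym_integrable.
have intg : nu.-integrable setT g by exact: Radon_Nikodym_integrable.
have intF : nu.-integrable setT F.
  rewrite (_ : F = (fun x => f x - alpha%:E * g x)^\+).
    by apply: integrable_funepos => //; apply: integrableB => //; exact: integrableZl.
  by apply/funext => x; rewrite funeposE /F maxC.
rewrite /hockey_stick -/nu -/f -/g -/F.
rewrite -(Radon_Nikodym_change_of_variables numu measurableT intF).
apply: ae_eq_integral => //.
- apply: emeasurable_funM; first exact: measurable_int intF.
  by apply: measurable_int; exact: Radon_Nikodym_integrable.
- apply: measurable_maxe => //; apply: emeasurable_funB.
    exact/measurable_EFinP.
  by apply: measurable_funeM; exact/measurable_EFinP.
have chP := Radon_Nikodym_chain_rule Pnu numu.
have chQ := Radon_Nikodym_chain_rule Qnu numu.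
have rn := ae_eq_Radon_Nikodym_SigmaFinite numu measurableT.
have {aep chP} := ae_eq_trans (ae_eq_sym aep) chP.
have {aeq chQ} := ae_eq_trans (ae_eq_sym aeq) chQ.
move=> cQ cP; apply: filterS3 rn cP cQ => x /(_ I) rnx /(_ I) cP /(_ I) cQ _.
have r0 : 0 <= Radon_Nikodym (charge_of_finite_measure nu) mu x.
  by rewrite -rnx; exact: Radon_Nikodym_SigmaFinite.f_ge0.
have rfin : Radon_Nikodym (charge_of_finite_measure nu) mu x \is a fin_num.
  exact: Radon_Nikodym_fin_num.
have ffin : f x \is a fin_num by exact: Radon_Nikodym_fin_num.
have gfin : g x \is a fin_num by exact: Radon_Nikodym_fin_num.
have -> : (p x)%:E = f x * Radon_Nikodym (charge_of_finite_measure nu) mu x.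
  exact: cP.
have -> : (q x)%:E = g x * Radon_Nikodym (charge_of_finite_measure nu) mu x.
  exact: cQ.
rewrite /F -(fineK rfin) -(fineK ffin) -(fineK gfin).
rewrite -!EFinM -!EFinB -!EFin_max -EFinM maxr_pMl ?fine_ge0//.
by rewrite mul0r mulrBl mulrA.
Qed.

End hockey_stick_densities.

Section finite_distributions.
Variable R : realType.

Record fdist (I : finType) := Fdist {
  pmf_of :> I -> R ;
  pmf_ge0 : forall i, 0 <= pmf_of i ;
  pmf_sum1 : \sum_i pmf_of i = 1 }.

Section mixture.
Context d (T : measurableType d) (I : finType).
Variables (w : fdist I) (Q : I -> probability T R).
Local Open Scope ereal_scope.

Definition mixture (A : set T) : \bar R := \sum_i (w i)%:E * Q i A.

Let mixture0 : mixture set0 = 0.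
Proof. by rewrite /mixture big1// => i _; rewrite measure0 mule0. Qed.

Let mixture_ge0 A : 0 <= mixture A.
Proof.
by apply: sume_ge0 => i _; rewrite mule_ge0// lee_fin; exact: pmf_ge0.
Qed.

Let mixture_sigma_additive : semi_sigma_additive mixture.
Proof.
pose m (n : nat) : {measure set T -> \bar R} :=
  if (insub n : option 'I_#|I|) is Some i then
    mscale (NngNum (pmf_ge0 w (enum_val i))) (Q (enum_val i)) else mzero.
have mE : mixture = msum m #|I|.
  apply/funext => A; rewrite /mixture /msum (reindex _ (onW_bij _ (enum_val_bij I))).
  by apply: eq_bigr => i _; rewrite /m valK.
rewrite mE; exact: measure_semi_sigma_additive.
Qed.

HB.instance Definition _ := isMeasure.Build _ _ _ mixture
  mixture0 mixture_ge0 mixture_sigma_additive.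

Let mixture_setT : mixture setT = 1.
Proof.
rewrite /mixture; under eq_bigr do rewrite probability_setT mule1.
by rewrite sumEFin pmf_sum1.
Qed.

HB.instance Definition _ :=
  Measure_isProbability.Build _ _ _ mixture mixture_setT.

End mixture.

Lemma uniform_perm_ge0 n (s : 'S_n) : 0 <= (n`!%:R : R)^-1.
Proof. by rewrite invr_ge0. Qed.

Lemma uniform_perm_sum1 n : \sum_(s : 'S_n) (n`!%:R : R)^-1 = 1.
Proof.
by rewrite sumr_const card_Sn -[LHS]mulr_natr mulVf// pnatr_eq0 -lt0n fact_gt0.
Qed.

Definition uniform_perm n : fdist 'S_n :=
  Fdist (@uniform_perm_ge0 n) (uniform_perm_sum1 n).

End finite_distributions.

HB.instance Definition _ n := isPointed.Build 'I_n.+1 ord0.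

HB.instance Definition _ n := @isMeasurable.Build default_measure_display
  'I_n.+1 discrete_measurable discrete_measurable0
  discrete_measurableC discrete_measurableU.

Section product_law.
Context d (T : measurableType d) (R : realType).

Definition cons_pair n (p : T * n.-tuple T) : n.+1.-tuple T :=
  [tuple of p.1 :: p.2].

Lemma measurable_cons_pair n : measurable_fun setT (@cons_pair n).
Proof. exact: measurable_cons. Qed.

HB.instance Definition _ n :=
  isMeasurableFun.Build _ _ _ _ (@cons_pair n) (@measurable_cons_pair n).

Fixpoint product_law n : n.-tuple (probability T R) ->
    probability (n.-tuple T) R :=
  if n is m.+1 then fun P =>
    distribution (thead P \x product_law [tuple of behead P])%E (@cons_pair m)
  else fun=> dirac [tuple].

Lemma product_law_box n (P : n.-tuple (probability T R)) (A : 'I_n -> set T) :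
  (forall i, measurable (A i)) ->
  product_law P [set t | forall i, A i (tnth t i)]
  = (\prod_(i < n) tnth P i (A i))%E.
Proof.
elim: n P A => [|n IHn] P A mA.
  rewrite big_ord0 /= (_ : mkset _ = setT) ?diracT//.
  by apply/seteqP; split => // t _ [].
have mB : measurable [set t : n.-tuple T | forall i, A (lift ord0 i) (tnth t i)].
  rewrite (_ : mkset _ = \bigcap_(i in [set: 'I_n])
      ((@tnth n T)^~ i @^-1` A (lift ord0 i))).
    apply: fin_bigcap_measurable => // i _.
    by rewrite -[X in measurable X]setTI; exact: measurable_tnth.
  by apply/seteqP; split => t At i => [_|]; [exact: At|exact: (At i I)].
rewrite /= /distribution /pushforward big_ord_recl.
rewrite (_ : _ @^-1` _ = A ord0 `*`
    [set t : n.-tuple T | forall i, A (lift ord0 i) (tnth t i)]).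
  rewrite product_measure1E//; congr (_ * _)%E.
  rewrite [LHS](IHn _ (fun i => A (lift ord0 i)))//.
  by apply: eq_bigr => i _; rewrite [in RHS](tuple_eta P) tnthS.
apply/seteqP; split => [[y t] /= At|[y t] /= [Ay At] i].
  split; first exact: (At ord0).
  by move=> i; have := At (lift ord0 i); rewrite /cons_pair tnthS.
case: (unliftP ord0 i) => [j ->|->] //.
by rewrite /cons_pair tnthS; exact: At.
Qed.

End product_law.

Section shuffling.
Context d (T : measurableType d) (R : realType).

Definition permute n (s : 'S_n) (t : n.-tuple T) : n.-tuple T :=
  [tuple tnth t (s i) | i < n].

Lemma measurable_permute n (s : 'S_n) : measurable_fun setT (permute s).
Proof.
apply/measurable_fun_tnthP => i.
rewrite (_ : _ \o _ = (@tnth n T)^~ (s i)); first exact: measurable_tnth.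
by apply/funext => t /=; rewrite tnth_mktuple.
Qed.

HB.instance Definition _ n (s : 'S_n) :=
  isMeasurableFun.Build _ _ _ _ (permute s) (measurable_permute s).

Definition shuffle n (P : probability (n.-tuple T) R) :
    probability (n.-tuple T) R :=
  mixture (uniform_perm R n) (fun s => distribution P (permute s)).

Definition shuffled_mechanism (X : Type) (Rz : X -> probability T R)
    n (x : n.-tuple X) : probability (n.-tuple T) R :=
  shuffle (product_law (map_tuple Rz x)).

Definition is_DP (X : Type) (eps0 : R) (Rz : X -> probability T R) : Prop :=
  forall x x' : X, hockey_stick (expR eps0) (Rz x) (Rz x') = 0%E.

End shuffling.

Section clone_reduction.
Context d (T : measurableType d) (R : realType) (X : Type).

(* The index i = 2, ..., n of the common users is an [i : 'I_m], n = m + 1. *)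
Record clone_decomposition (Rz : X -> probability T R) (x10 x11 : X)
    (m : nat) (x : m.-tuple X) := CloneDecomposition {
  clone_k : nat ;
  clone_Q1 : 'I_clone_k -> probability T R ;
  clone_Q : 'I_m -> probability T R ;
  clone_a : 'I_clone_k -> R ;
  clone_b : 'I_clone_k -> R ;
  clone_c : 'I_clone_k -> R ;
  clone_beta : R ;
  clone_k_ge1 : (1 <= clone_k)%N ;
  clone_a_ge0 : forall j, 0 <= clone_a j ;
  clone_b_ge0 : forall j, 0 <= clone_b j ;
  clone_c_ge0 : forall j, 0 <= clone_c j ;
  clone_beta_ge0 : 0 <= clone_beta ;
  clone_a_sum1 : \sum_j clone_a j = 1 ;
  clone_b_sum1 : \sum_j clone_b j = 1 ;
  clone_c_sum1 : clone_beta + \sum_j clone_c j = 1 ;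
  clone_x10 : forall A, measurable A ->
    Rz x10 A = (\sum_j (clone_a j)%:E * clone_Q1 j A)%E ;
  clone_x11 : forall A, measurable A ->
    Rz x11 A = (\sum_j (clone_b j)%:E * clone_Q1 j A)%E ;
  clone_x : forall (i : 'I_m) A, measurable A ->
    Rz (tnth x i) A = ((\sum_j (clone_c j)%:E * clone_Q1 j A)
                       + clone_beta%:E * clone_Q i A)%E }.

End clone_reduction.
Arguments clone_Q1 {d T R X Rz x10 x11 m x}.
Arguments clone_a {d T R X Rz x10 x11 m x}.
Arguments clone_b {d T R X Rz x10 x11 m x}.
Arguments clone_c {d T R X Rz x10 x11 m x}.
Arguments clone_a_ge0 {d T R X Rz x10 x11 m x}.
Arguments clone_b_ge0 {d T R X Rz x10 x11 m x}.
Arguments clone_c_ge0 {d T R X Rz x10 x11 m x}.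

Section extend_pmf.
Context (R : realType) (k : nat).
Variables (w : 'I_k -> R) (r : R).
Hypotheses (w_ge0 : forall j, 0 <= w j) (r_ge0 : 0 <= r)
  (w_sum1 : r + \sum_j w j = 1).

(* The outcomes 1, ..., k are [lift ord_max j], and k + 1 is [ord_max]. *)
Definition extend_pmf (i : 'I_k.+1) : R :=
  if unlift ord_max i is Some j then w j else r.

Let extend_pmf_ge0 i : 0 <= extend_pmf i.
Proof. by rewrite /extend_pmf; case: unliftP. Qed.

Let extend_pmf_sum1 : \sum_i extend_pmf i = 1.
Proof.
rewrite (bigD1_ord ord_max)//= {1}/extend_pmf unlift_none -[RHS]w_sum1.
by congr (_ + _); apply: eq_bigr => j _; rewrite /extend_pmf liftK.
Qed.

Definition extend_fdist : fdist R 'I_k.+1 :=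
  Fdist extend_pmf_ge0 extend_pmf_sum1.

End extend_pmf.

Section histogram.
Variable k : nat.

Definition histogram n (t : n.-tuple 'I_k.+1) : k.+1.-tuple nat :=
  [tuple count_mem j t | j < k.+1].

Lemma measurable_ord_tuple n (A : set (n.-tuple 'I_k.+1)) : measurable A.
Proof.
have -> : A = \big[setU/set0]_(t in [set t : n.-tuple 'I_k.+1 | `[< A t >]]%SET)
    \bigcap_(i in [set: 'I_n]) ((@tnth n _)^~ i @^-1` [set tnth t i]).
  apply/seteqP; split=> [t At|t].
    rewrite -bigcup_seq_cond; exists t; last by [].
    by rewrite /= mem_index_enum inE; apply/asboolP.
  rewrite -bigcup_seq_cond => -[u /=]; rewrite inE => /andP[_ /asboolP Au] ut.
  suff -> : t = u by [].
  by apply: eq_from_tnth => i; exact: ut.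
apply: bigsetU_measurable => t _; apply: fin_bigcap_measurable => // i _.
by rewrite -[X in measurable X]setTI; exact: measurable_tnth.
Qed.

Lemma measurable_histogram n : measurable_fun setT (@histogram n).
Proof. by move=> _ A _; exact: measurable_ord_tuple. Qed.

HB.instance Definition _ n :=
  isMeasurableFun.Build _ _ _ _ (@histogram n) (@measurable_histogram n).

End histogram.

Section reduction_pair.
Context d (T : measurableType d) (R : realType) (X : Type).
Context (Rz : X -> probability T R) (x10 x11 : X) (m : nat) (x : m.-tuple X).
Variable C : clone_decomposition Rz x10 x11 x.
Let k := clone_k C.

Let a_sum1 : 0 + \sum_j clone_a C j = 1.
Proof. by rewrite add0r clone_a_sum1. Qed.

Let b_sum1 : 0 + \sum_j clone_b C j = 1.
Proof. by rewrite add0r clone_b_sum1. Qed.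

Definition law_of (w : fdist R 'I_k.+1) : probability 'I_k.+1 R :=
  mixture w (fun i => dirac i).

Definition clone_A0 : probability 'I_k.+1 R :=
  law_of (extend_fdist (clone_a_ge0 C) (lexx 0) a_sum1).

Definition clone_A1 : probability 'I_k.+1 R :=
  law_of (extend_fdist (clone_b_ge0 C) (lexx 0) b_sum1).

Definition clone_A2 : probability 'I_k.+1 R :=
  law_of (extend_fdist (clone_c_ge0 C) (clone_beta_ge0 C) (clone_c_sum1 C)).

Definition clone_hist (A : probability 'I_k.+1 R) :
    probability (k.+1.-tuple nat) R :=
  distribution (product_law [tuple of A :: nseq m clone_A2])
               (@histogram k m.+1).

Definition P0_GC := clone_hist clone_A0.
Definition P1_GC := clone_hist clone_A1.

End reduction_pair.

(* Main.v *)
(* Expand each input law over the vector [t] of labels drawn by the n users: the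
   shuffled mechanism and the histogram become mixtures over [t] with the same
   weights. These weights are invariant under permutations of positions 2..n,
   so each component may be averaged over such permutations. The average depends
   on [t] only through its histogram, as long as user 1 does not draw the label
   k + 1, which has weight zero there. So the shuffled mechanisms are the images
   of the two histograms under one Markov kernel, and the data processing
   inequality applies, since the hockey-stick divergence is the maximum of
   [P A - alpha * Q A] over events [A]. *)
From mathcomp Require Import all_boot all_order all_algebra perm.
From mathcomp Require Import all_classical all_reals all_analysis.
From mathcomp Require Import measurable_realfun.
Require Import Defs.

Import Order.TTheory GRing.Theory Num.Theory.

Set Implicit Arguments.
Unset Strict Implicit.
Unset Printing Implicit Defensive.

Local Open Scope ring_scope.
Local Open Scope classical_set_scope.

(** * Hockey-stick divergence as a maximum over events *)

Section hockey_stick_events.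
Context d (T : measurableType d) (R : realType).
Variables (alpha : R) (P Q : probability T R).
Local Open Scope ereal_scope.

Let nu : {finite_measure set T -> \bar R} := reference P Q.
Let F x := density P nu x - alpha%:E * density Q nu x.

Let nuE A : nu A = P A + Q A.
Proof. by rewrite -measure_addE. Qed.

Let P_dom : charge_of_finite_measure P `<< nu.
Proof.
apply/null_content_dominatesP => A mA A0.
have /eqP : P A + Q A = 0 by rewrite -nuE; exact: A0.
by rewrite padde_eq0// => /andP[/eqP].
Qed.

Let Q_dom : charge_of_finite_measure Q `<< nu.
Proof.
apply/null_content_dominatesP => A mA A0.
have /eqP : P A + Q A = 0 by rewrite -nuE; exact: A0.
by rewrite padde_eq0// => /andP[_ /eqP].
Qed.

Let intP : nu.-integrable setT (density P nu).
Proof. exact: Radon_Nikodym_integrable. Qed.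

Let intQ : nu.-integrable setT (density Q nu).
Proof. exact: Radon_Nikodym_integrable. Qed.

Let intF : nu.-integrable setT F.
Proof. by apply: integrableB => //; exact: integrableZl. Qed.

Let mF : measurable_fun setT F.
Proof. exact: measurable_int intF. Qed.

Let eventE A : measurable A ->
  P A - alpha%:E * Q A = \int[nu]_(x in A) F x.
Proof.
move=> mA.
have intA f : nu.-integrable setT f -> nu.-integrable A f.
  by apply: integrableS.
rewrite /F integralB//; first last.
- by apply: integrableZl => //; exact: intA.
- exact: intA.
rewrite integralZl//; last exact: intA.
by rewrite -!(Radon_Nikodym_integral _ mA).
Qed.

Let hockey_stickE : hockey_stick alpha P Q = \int[nu]_x maxe 0 (F x).
Proof. by []. Qed.

(** Replacing [F] by its positive part, and then [A] by the whole space, can only increase the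
    integral of [F] over [A]. *)
Lemma hockey_stick_ge A : measurable A ->
  P A - alpha%:E * Q A <= hockey_stick alpha P Q.
Proof.
move=> mA; rewrite eventE// hockey_stickE.
have mmax : measurable_fun setT (fun x => maxe 0 (F x)).
  exact: measurable_maxe.
apply: (@le_trans _ _ (\int[nu]_(x in A) maxe 0 (F x))); last first.
  by apply: ge0_subset_integral => // x _; rewrite le_max lexx.
rewrite (_ : (fun x => maxe 0 (F x)) = F^\+); last first.
  by apply/funext => x; rewrite funeposE maxC.
apply: le_integral => //; first exact: integrableS intF.
  by apply: integrable_funepos => //; exact: integrableS intF.
by move=> x _; rewrite funeposE le_max lexx.
Qed.

(** The maximum is reached where the difference of densities [F] is positive: the integrand equals
    [F] there and 0 elsewhere. *)
Lemma hockey_stick_attained :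
  exists2 A, measurable A & hockey_stick alpha P Q = P A - alpha%:E * Q A.
Proof.
pose A := [set x | 0 < F x].
have mA : measurable A.
  by rewrite -[A]setTI; exact: emeasurable_fun_o_infty.
exists A => //; rewrite eventE// hockey_stickE [RHS]integral_mkcond.
apply: eq_integral => x _; rewrite patchE.
case: ifPn => [|]; rewrite ?inE ?notin_setE /A /=.
  by move=> /ltW /max_idPr.
by move=> /negP; rewrite -leNgt => /max_idPl.
Qed.

End hockey_stick_events.

(** * Product laws, their determination by boxes, and permutations of coordinates *)

Section product_law_facts.
Context d (T : measurableType d) (R : realType).
Local Open Scope ereal_scope.

Definition box n (A : 'I_n -> set T) : set (n.-tuple T) :=
  [set t | forall i, A i (tnth t i)].

Lemma measurable_box n (A : 'I_n -> set T) :
  (forall i, measurable (A i)) -> measurable (box A).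
Proof.
move=> mA.
rewrite (_ : box A = \bigcap_(i in [set: 'I_n]) ((@tnth n T)^~ i @^-1` A i)).
  apply: fin_bigcap_measurable => // i _.
  by rewrite -[X in measurable X]setTI; exact: measurable_tnth.
by apply/seteqP; split => t At i => [_|]; [exact: At|exact: (At i I)].
Qed.

Lemma measurable_tuple_boxes n :
  @measurable _ (n.-tuple T) =
  <<s [set B | exists2 A, (forall i, measurable (A i)) & B = @box n A] >>.
Proof.
apply/seteqP; split.
- apply: smallest_sub; first exact: smallest_sigma_algebra.
  rewrite -bigcup_seq => _ [i _ [B mB <-]]; apply: sub_sigma_algebra.
  (* A cylinder over one coordinate is a box whose other sides are the whole space. *)
  exists (fun j => if j == i then B else setT).
    by move=> j; case: ifP.
  rewrite setTI; apply/seteqP; split=> [t Bt j|t /(_ i)].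
    by case: eqP => // ->.
  by rewrite eqxx.
- apply: smallest_sub; first exact: sigma_algebra_measurable.
  by move=> _ [A mA ->]; exact: measurable_box.
Qed.

(** Boxes are stable under intersection and generate the sigma-algebra, so two probabilities that
    agree on them are equal. *)
Lemma product_law_unique n (P : n.-tuple (probability T R))
    (mu : probability (n.-tuple T) R) :
  (forall A, (forall i, measurable (A i)) ->
     mu (box A) = \prod_(i < n) tnth P i (A i)) ->
  forall B, measurable B -> product_law P B = mu B.
Proof.
move=> muE B mB.
apply: (measure_unique _ (fun=> setT) (measurable_tuple_boxes n)) => //.
- move=> _ _ [A mA ->] [A' mA' ->]; exists (fun i => A i `&` A' i).
    by move=> i; exact: measurableI.
  by apply/seteqP; split=> t /= => [[At A't] i|At];
    [split; [exact: At|exact: A't]|split=> i; case: (At i)].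
- by move=> _; exists (fun=> setT) => //; apply/seteqP; split.
- by rewrite bigcup_const.
- by move=> _ [A mA ->]; exact: etrans (product_law_box P mA) (esym (muE _ mA)).
- move=> _; apply: le_lt_trans (ltry 1%R).
  exact: (probability_le1 (product_law P) measurableT).
Qed.

Lemma box_permute n (s : 'S_n) (A : 'I_n -> set T) :
  permute s @^-1` box A = box (fun i => A ((s^-1)%g i)).
Proof.
apply/seteqP; split=> t /= At i.
  by have := At ((s^-1)%g i); rewrite tnth_mktuple permKV.
by have := At (s i); rewrite permK tnth_mktuple.
Qed.

Lemma product_law_permute n (s : 'S_n) (P : n.-tuple (probability T R)) B :
  measurable B ->
  product_law [tuple tnth P (s i) | i < n] B =
  product_law P (permute s @^-1` B).
Proof.
move=> mB.
rewrite -[RHS]/(distribution (product_law P) (permute s) B).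
apply: product_law_unique => // A mA.
rewrite -[LHS]/(product_law P (permute s @^-1` box A)) box_permute.
rewrite [LHS]product_law_box//.
rewrite (reindex_inj (@perm_inj _ s)); apply: eq_bigr => i _.
by rewrite permK tnth_mktuple.
Qed.

Lemma permuteM n (s u : 'S_n) (t : n.-tuple T) :
  permute s (permute u t) = permute (s * u)%g t.
Proof. by apply: eq_from_tnth => i; rewrite !tnth_mktuple permM. Qed.

(** The uniform law on permutations is invariant under translation by [s], so a prior reordering of
    the inputs is forgotten. *)
Lemma shuffle_permute n (s : 'S_n) (P : n.-tuple (probability T R)) B :
  measurable B ->
  shuffle (product_law [tuple tnth P (s i) | i < n]) B =
  shuffle (product_law P) B.
Proof.
move=> mB; rewrite /shuffle /= /mixture.
rewrite [RHS](reindex_inj (mulIg s)); apply: eq_bigr => u _; congr (_ * _).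
transitivity (product_law P (permute s @^-1` (permute u @^-1` B))).
  apply: product_law_permute.
  by rewrite -[X in measurable X]setTI; exact: measurable_permute.
by congr (product_law P _); apply/seteqP; split=> t /=; rewrite permuteM.
Qed.

End product_law_facts.

(** * Products of mixtures as mixtures of products *)

Section product_weights.
Context (R : realType) (I : finType) (n : nat) (w : 'I_n -> fdist R I).

Definition product_pmf (t : {ffun 'I_n -> I}) : R := \prod_(i < n) w i (t i).

Lemma product_pmf_ge0 t : 0 <= product_pmf t.
Proof. by apply: prodr_ge0 => i _; exact: pmf_ge0. Qed.

Lemma product_pmf_sum1 : \sum_t product_pmf t = 1.
Proof.
rewrite -(bigA_distr_bigA (fun i j => w i j)) big1// => i _.
exact: pmf_sum1.
Qed.

Definition product_fdist : fdist R {ffun 'I_n -> I} :=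
  Fdist product_pmf_ge0 product_pmf_sum1.

(** On a box this is the expansion of a product of sums into a sum over all choice functions; boxes
    suffice by [product_law_unique]. *)
Lemma product_law_mixture d (T : measurableType d)
    (Q : 'I_n -> I -> probability T R) (P : n.-tuple (probability T R)) :
  (forall i A, measurable A -> tnth P i A = mixture (w i) (Q i) A) ->
  forall B, measurable B -> product_law P B =
    mixture product_fdist
      (fun t => product_law [tuple Q i (t i) | i < n]) B.
Proof.
move=> PE; apply: product_law_unique => A mA; rewrite /mixture.
have fin i j : Q i j (A i) = (fine (Q i j (A i)))%:E.
  by rewrite fineK// fin_num_measure.
transitivity (\sum_(t : {ffun 'I_n -> I})
    \prod_i (w i (t i) * fine (Q i (t i) (A i))))%:E%E.
  rewrite -sumEFin; apply: eq_bigr => t _ /=; rewrite big_split EFinM /=.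
  congr (_ * _)%E; rewrite [LHS]product_law_box// -prodEFin.
  by apply: eq_bigr => i _; rewrite tnth_mktuple -fin.
rewrite -(bigA_distr_bigA (fun i j => w i j * fine (Q i j (A i)))).
rewrite -prodEFin; apply: eq_bigr => i _.
rewrite PE// /mixture -sumEFin; apply: eq_bigr => j _.
by rewrite EFinM -fin.
Qed.

End product_weights.

(** * Shuffled mixtures and products of point masses *)

Section shuffled_mixture.
Context d (T : measurableType d) (R : realType).
Local Open Scope ereal_scope.

Lemma shuffle_mixture n (J : finType) (w : fdist R J)
    (P : J -> probability (n.-tuple T) R) (L : probability (n.-tuple T) R) B :
  (forall A, measurable A -> L A = mixture w P A) ->
  measurable B ->
  shuffle L B = mixture w (fun j => shuffle (P j)) B.
Proof.
move=> LE mB; rewrite /shuffle /= /mixture.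
transitivity (\sum_s \sum_j (uniform_perm R n s)%:E *
    ((w j)%:E * P j (permute s @^-1` B))).
  apply: eq_bigr => s _.
  rewrite -ge0_sume_distrr; last first.
    by move=> j _; rewrite mule_ge0// lee_fin pmf_ge0.
  congr (_ * _); apply: LE.
  by rewrite -[X in measurable X]setTI; exact: measurable_permute.
rewrite exchange_big; apply: eq_bigr => j _ /=.
rewrite ge0_sume_distrr; last first.
  by move=> s _; rewrite mule_ge0// lee_fin pmf_ge0.
by apply: eq_bigr => s _; rewrite muleCA.
Qed.

Lemma product_law_dirac n (t : n.-tuple T) (P : n.-tuple (probability T R)) :
  (forall i A, measurable A -> tnth P i A = \d_(tnth t i) A) ->
  forall B, measurable B -> product_law P B = \d_t B.
Proof.
move=> PE; apply: product_law_unique => A mA.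
under eq_bigr do rewrite PE//.
rewrite /= diracE.
have [At|At] := pselect (box A t).
  rewrite mem_set// big1// => i _; rewrite diracE mem_set//; exact: At.
rewrite memNset//; have /existsNP[i Ai] := At.
by rewrite (bigD1 i)//= diracE memNset// mul0e.
Qed.

End shuffled_mixture.

(** Discrete data processing: [c] is a signed weight, [g] a kernel evaluated at one event. On the
    support of [c] within a class, [g] has a single value v in [0, 1], so a class of total weight S
    contributes S v, at most max(0, S). *)
Lemma sum_class_le (R : realDomainType) (J K : finType) (cl : J -> K)
    (c g : J -> R) :
  (forall t, 0 <= g t <= 1) ->
  (forall t t', c t != 0 -> c t' != 0 -> cl t = cl t' -> g t = g t') ->
  \sum_t c t * g t <= \sum_(t | 0 < \sum_(t' | cl t' == cl t) c t') c t.
Proof.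
move=> g01 gcl; rewrite (partition_big cl predT)//.
rewrite [leRHS](partition_big cl predT)//=.
apply: ler_sum => C _.
(* The selecting condition depends only on the class, so a class is kept entirely or dropped. *)
rewrite [leRHS](_ : _ = if 0 < \sum_(t' | cl t' == C) c t' then
    \sum_(t' | cl t' == C) c t' else 0); last first.
  case: ifPn => SC.
    by apply: eq_bigl => t; case: eqVneq => [->|]; rewrite ?SC ?andbF.
  by rewrite big1// => t /andP[+ /eqP tC]; rewrite tC (negbTE SC).
have [[t0 tC ct0]|nex] := pselect (exists2 t, cl t == C & c t != 0); last first.
  have c0 t : cl t == C -> c t = 0.
    by move=> tC; apply/eqP/negP => /negP ct; apply: nex; exists t.
  by rewrite !big1 ?ltxx// => t tC; rewrite c0// mul0r.
rewrite (eq_bigr (fun t => c t * g t0)); last first.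
  move=> t /eqP tC'; have [->|ct] := eqVneq (c t) 0; first by rewrite !mul0r.
  by rewrite (gcl t t0)// tC' (eqP tC).
rewrite -mulr_suml; have /andP[g0 g1] := g01 t0.
case: ltP => [S0|S0]; first by rewrite ler_piMr// ltW.
exact: mulr_le0_ge0.
Qed.

(** * The kernel from label vectors to shuffled outputs, evaluated at an event [E] *)

Section clone_kernel.
Context d (T : measurableType d) (R : realType) (I : finType) (m : nat).
Variables (z : I) (Q : 'I_m.+1 -> I -> probability T R).
Hypothesis Qz : forall i i' j, j != z -> Q i j = Q i' j.
Variable E : set (m.+1.-tuple T).
Hypothesis mE : measurable E.

Let stab (s : 'S_m.+1) := s ord0 == ord0.

(** Position [i] uses the components of user [s i]; by [Qz] the user matters only where the label is
    [z]. *)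
Definition clone_law (s : 'S_m.+1) (t : {ffun 'I_m.+1 -> I}) :=
  product_law [tuple Q (s i) (t i) | i < m.+1].

Definition clone_kernel s t : R := fine (shuffle (clone_law s t) E).

Lemma clone_kernelE s t : (clone_kernel s t)%:E = shuffle (clone_law s t) E.
Proof. by rewrite fineK// fin_num_measure. Qed.

Lemma eq_clone_kernel (s s' : 'S_m.+1) (t t' : {ffun 'I_m.+1 -> I}) :
  (forall i, Q (s i) (t i) = Q (s' i) (t' i)) ->
  clone_kernel s t = clone_kernel s' t'.
Proof. by move=> eqQ; rewrite /clone_kernel /clone_law (eq_mktuple _ eqQ). Qed.

Definition permute_ffun (s : 'S_m.+1) (t : {ffun 'I_m.+1 -> I}) :
  {ffun 'I_m.+1 -> I} := [ffun i => t (s i)].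

Lemma permute_ffunK s : cancel (permute_ffun s) (permute_ffun (s^-1)%g).
Proof. by move=> t; apply/ffunP => i; rewrite !ffunE permKV. Qed.

(** Shuffling ignores positions, so moving the labels by [p] amounts to moving the users by the
    inverse of [p]. *)
Lemma clone_kernel_permute s p t :
  clone_kernel s (permute_ffun p t) = clone_kernel (p^-1 * s)%g t.
Proof.
rewrite /clone_kernel /clone_law.
pose P := [tuple Q ((p^-1 * s)%g i) (t i) | i < m.+1].
have -> : [tuple Q (s i) (permute_ffun p t i) | i < m.+1] =
          [tuple tnth P (p i) | i < m.+1].
  by apply: eq_from_tnth => i; rewrite !tnth_mktuple ffunE permM permK.
by rewrite (shuffle_permute p P mE).
Qed.

(** Averaging over the permutations that fix the first user makes the value depend only on the
    histogram of [t], among the [t] with [t ord0 != z]. *)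
Definition clone_kernel_avg t : R :=
  #|[pred s | stab s]|%:R^-1 * \sum_(s | stab s) clone_kernel s t.

Let stab_gt0 : (0 < #|[pred s | stab s]|)%N.
Proof. by apply/card_gt0P; exists 1%g; rewrite inE /stab perm1. Qed.

Lemma clone_kernel_avg_itv t : 0 <= clone_kernel_avg t <= 1.
Proof.
have k01 s : 0 <= clone_kernel s t <= 1.
  by rewrite -!lee_fin clone_kernelE measure_ge0 probability_le1.
apply/andP; split.
  by rewrite mulr_ge0// sumr_ge0// => s _; case/andP: (k01 s).
rewrite ler_pdivrMl ?ltr0n// mulr1 -sumr_const.
by apply: ler_sum => s _; case/andP: (k01 s).
Qed.

(* A permutation [p] carrying [t] to [t'] may move position [0], but only onto
   another position whose label is not [z]; exchanging these two does not change
   which [Q] is used anywhere, so [p] can be replaced by one fixing [0]. *)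
Lemma clone_kernel_avg_perm (t t' : {ffun 'I_m.+1 -> I}) :
  t ord0 != z -> t' ord0 != z ->
  perm_eq [tuple t' i | i < m.+1] [tuple t i | i < m.+1] ->
  clone_kernel_avg t' = clone_kernel_avg t.
Proof.
move=> tz t'z /tuple_permP[p pE].
have {pE} t'E : t' = permute_ffun p t.
  apply/ffunP => i; rewrite ffunE.
  have /(congr1 (fun s => nth z s i)) := pE.
  by rewrite -!tnth_nth !tnth_mktuple.
pose r := (p * tperm ord0 (p ord0))%g.
have r0 : (r^-1)%g ord0 = ord0.
  by rewrite -{1}[ord0](_ : r ord0 = ord0) ?permK// permM tpermR.
congr (_ * _); rewrite [RHS](reindex_inj (mulgI (r^-1)%g)).
apply: eq_big => [s|s _]; first by rewrite /stab permM r0.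
rewrite t'E clone_kernel_permute; apply: eq_clone_kernel => i.
have [tiz|] := eqVneq (t i) z; last exact: Qz.
congr (Q _ _); rewrite !permM; congr (s _).
rewrite /r invgM permM tpermV tpermD//.
  by apply: contraNneq tz => ->; rewrite tiz.
by apply: contraNneq t'z; rewrite t'E ffunE => ->; rewrite tiz.
Qed.

(** All positions but the first share the label law [v], so the weights are invariant under the
    permutations fixing [ord0], and every term of the average has the same weighted sum. *)
Lemma clone_kernel_avgE (u v : fdist R I) :
  let w := product_pmf (fun i : 'I_m.+1 => if i == ord0 then u else v) in
  \sum_t w t * clone_kernel 1%g t = \sum_t w t * clone_kernel_avg t.
Proof.
move=> w.
have wE s t : stab s -> w (permute_ffun s t) = w t.
  move=> /eqP s0; rewrite /w /product_pmf [RHS](reindex_inj (@perm_inj _ s)).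
  apply: eq_bigr => i _; rewrite ffunE.
  have -> // : (s i == ord0) = (i == ord0).
  by rewrite -{1}s0 (inj_eq (@perm_inj _ s)).
have sumE s : stab s ->
    \sum_t w t * clone_kernel s t = \sum_t w t * clone_kernel 1%g t.
  (* The substitution keeps the weight and replaces the user permutation [s] by [s^-1 * s], the
     identity. *)
  move=> ss; rewrite (reindex_inj (can_inj (permute_ffunK s))).
  apply: eq_bigr => t _.
  by rewrite wE// clone_kernel_permute mulVg.
under [RHS]eq_bigr do rewrite mulrCA mulr_sumr.
rewrite -mulr_sumr exchange_big/= (eq_bigr _ sumE) sumr_const.
rewrite -[X in _ * X]mulr_natl mulrA mulVf ?mul1r//.
by rewrite pnatr_eq0 -lt0n.
Qed.

End clone_kernel.

Lemma mixture_fine d (T : measurableType d) (R : realType) (J : finType)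
    (w : fdist R J) (P : J -> probability T R) A : measurable A ->
  mixture w P A = (\sum_j w j * fine (P j A))%:E.
Proof.
move=> mA; rewrite -sumEFin; apply: eq_bigr => j _.
by rewrite EFinM fineK// fin_num_measure.
Qed.

(** * Shuffled mechanism and histogram expanded over label vectors *)

Section clone_reduction_laws.
Context d (T : measurableType d) (R : realType) (X : Type).
Variables (Rz : X -> probability T R) (x10 x11 : X) (m : nat) (x : m.-tuple X).
Variable C : clone_decomposition Rz x10 x11 x.
Notation I := 'I_(clone_k C).+1.
Let n := m.+1.

Definition clone_common : fdist R I :=
  extend_fdist (clone_c_ge0 C) (clone_beta_ge0 C) (clone_c_sum1 C).

Definition clone_weight (u : fdist R I) : fdist R {ffun 'I_n -> I} :=
  product_fdist (fun i : 'I_n => if i == ord0 then u else clone_common).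

(* Position [0] never draws the last label, so its component for that label
   is irrelevant. *)
Definition clone_component (i : 'I_n) (j : I) : probability T R :=
  if unlift ord_max j is Some j' then clone_Q1 C j'
  else if unlift ord0 i is Some i' then clone_Q C i' else Rz x10.

Lemma clone_component_first (y : X) (w : 'I_(clone_k C) -> R)
    (u : fdist R I) A : measurable A ->
  (forall i, u i = extend_pmf w 0 i) ->
  Rz y A = (\sum_j (w j)%:E * clone_Q1 C j A)%E ->
  Rz y A = mixture u (clone_component ord0) A.
Proof.
move=> mA uE ->; rewrite /mixture (bigD1_ord ord_max)//=.
rewrite uE {1}/extend_pmf unlift_none mul0e add0e.
apply: eq_bigr => j _.
by rewrite uE /extend_pmf /clone_component liftK.
Qed.

Lemma clone_component_common (i : 'I_m) A : measurable A ->
  Rz (tnth x i) A = mixture clone_common (clone_component (lift ord0 i)) A.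
Proof.
move=> mA; rewrite (clone_x C i mA) /mixture (bigD1_ord ord_max)//= addeC.
rewrite /clone_component {1}/extend_pmf unlift_none liftK.
congr (_ + _)%E; apply: eq_bigr => j _.
by rewrite /extend_pmf liftK.
Qed.

Lemma shuffled_mechanismE (y : X) (w : 'I_(clone_k C) -> R) (u : fdist R I) E :
  measurable E ->
  (forall i, u i = extend_pmf w 0 i) ->
  (forall A, measurable A -> Rz y A = (\sum_j (w j)%:E * clone_Q1 C j A)%E) ->
  shuffled_mechanism Rz [tuple of y :: x] E =
  (\sum_t clone_weight u t * clone_kernel clone_component E 1%g t)%:E.
Proof.
move=> mE uE yE; rewrite /shuffled_mechanism.
rewrite (shuffle_mixture (w := clone_weight u)
  (P := fun t => clone_law clone_component 1%g t))//; last first.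
  rewrite /clone_law => A mA.
  under [RHS]eq_bigr do under eq_mktuple do rewrite perm1.
  apply: product_law_mixture => // i B mB.
  rewrite tnth_map; case: (unliftP ord0 i) => [j ->|->].
    have -> : tnth [tuple of y :: x] (lift ord0 j) = tnth x j.
      by rewrite !(tnth_nth y).
    by rewrite clone_component_common.
  exact: clone_component_first (yE _ mB).
exact: mixture_fine.
Qed.

(** With point masses as components, each label vector yields a deterministic histogram; the weights
    are those of [shuffledmechanismE] with an underscore-free reading: the same [clone_weight u]. *)
Lemma clone_histE (u : fdist R I) (B : set _) : measurable B ->
  clone_hist (C := C) (mixture u (fun i => dirac i)) B =
  (\sum_(t : {ffun 'I_n -> I} | histogram [tuple t i | i < n] \in B)
     clone_weight u t)%:E.
Proof.
move=> mB; rewrite -[LHS]/(product_law _ (@histogram _ n @^-1` B)).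
rewrite (product_law_mixture
  (w := fun i : 'I_n => if i == ord0 then u else clone_common)
  (Q := fun _ i => dirac i)); last exact: measurable_ord_tuple.
  rewrite mixture_fine ?big_mkcond; last exact: measurable_ord_tuple.
  congr EFin; rewrite [RHS]big_mkcond; apply: eq_bigr => t _.
  rewrite (product_law_dirac (t := [tuple t i | i < n]));
    last exact: measurable_ord_tuple.
    rewrite diracE; case: ifPn => tB.
      by rewrite mem_set ?mulr1//; rewrite inE in tB.
    by rewrite memNset ?mulr0//; rewrite notin_setE in tB.
  by move=> i A mA; rewrite !tnth_mktuple.
move=> i A mA; case: (unliftP ord0 i) => [j ->|->] //.
by rewrite (tnth_nth (clone_A2 C))/= nth_nseq ltn_ord.
Qed.

End clone_reduction_laws.

(** * Comparison of the two divergences *)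

Theorem theorem4 (R : realType) (d : measure_display) (Y : measurableType d)
    (X : Type) (Rz : X -> probability Y R) (eps0 eps : R) (m : nat)
    (x10 x11 : X) (x : m.-tuple X) :
  is_DP eps0 Rz -> 0 <= eps -> x10 <> x11 ->
  forall C : clone_decomposition Rz x10 x11 x,
  (hockey_stick (expR eps) (shuffled_mechanism Rz [tuple of x10 :: x])
                           (shuffled_mechanism Rz [tuple of x11 :: x])
   <= hockey_stick (expR eps) (P0_GC C) (P1_GC C))%E.
Proof.
move=> _ _ _ C.
(* Stating existence exposes only the weights of the label law, not the proofs packed with them. *)
have [u0 [A0E u0E]] : exists u : fdist R 'I_(clone_k C).+1,
    clone_A0 C = mixture u (fun i => dirac i) /\
    (forall i, u i = extend_pmf (clone_a C) 0 i).
  by eexists; split; [reflexivity|].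
have [u1 [A1E u1E]] : exists u : fdist R 'I_(clone_k C).+1,
    clone_A1 C = mixture u (fun i => dirac i) /\
    (forall i, u i = extend_pmf (clone_b C) 0 i).
  by eexists; split; [reflexivity|].
have [E mE ->] := hockey_stick_attained (expR eps)
  (shuffled_mechanism Rz [tuple of x10 :: x])
  (shuffled_mechanism Rz [tuple of x11 :: x]).
rewrite (shuffled_mechanismE mE u0E (clone_x10 C)).
rewrite (shuffled_mechanismE mE u1E (clone_x11 C)).
rewrite !clone_kernel_avgE//.
(* The same kernel [g] now serves both inputs; only the label weights differ. *)
set g := clone_kernel_avg _ _.
pose c t := clone_weight u0 t - expR eps * clone_weight u1 t.
pose hist (t : {ffun 'I_m.+1 -> 'I_(clone_k C).+1}) :=
  histogram [tuple t i | i < m.+1].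
(* Classes must lie in a finite type, which tuples of naturals do not form, so a histogram is
   encoded by the indicator of its fibre. *)
pose cl t := [ffun t' => hist t' == hist t].
have clP t t' : (cl t' == cl t) = (hist t' == hist t).
  apply/eqP/eqP => [/ffunP/(_ t')|tt'].
    by rewrite !ffunE eqxx => /esym/eqP.
  by apply/ffunP => t''; rewrite !ffunE tt'.
(* [B] collects the histograms whose fibre has positive total signed weight, the event that favours
   [P0_GC] most. *)
pose B := [set h | exists2 t, h = hist t & 0 < \sum_(t' | cl t' == cl t) c t'].
have mB : measurable B.
  apply: countable_measurable; last exact: countableP.
  move=> h; rewrite (_ : [set h] = box (fun i => [set tnth h i])).
    by apply: measurable_box.
  by apply/seteqP; split=> [_ -> //|h' hh']; apply: eq_from_tnth.
apply: le_trans (hockey_stick_ge (expR eps) (P0_GC C) (P1_GC C) mB).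
rewrite /P0_GC /P1_GC A0E A1E !clone_histE// -!EFinM -!EFinB lee_fin.
rewrite !mulr_sumr -!sumrB.
have inB t : (hist t \in B) = (0 < \sum_(t' | cl t' == cl t) c t').
  apply/idP/idP => [|t0]; last by rewrite inE; exists t.
  rewrite inE => -[t1 tt1]; have /eqP -> // : cl t == cl t1 by rewrite clP tt1.
rewrite (eq_bigl _ _ inB).
rewrite [leLHS](eq_bigr (fun t => c t * g t)); last first.
  by move=> t _; rewrite /c mulrBl -mulrA.
apply: sum_class_le => [t|t t' ct ct' tt']; first exact: clone_kernel_avg_itv.
(* Under either input the first user draws the label k + 1 with weight zero, so both terms of [c]
   vanish there. *)
have c0 s : c s != 0 -> s ord0 != ord_max.
  apply: contraNneq => s0; rewrite /c /= /product_pmf.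
  rewrite !big_ord_recl/= u0E u1E s0 /extend_pmf unlift_none.
  by rewrite !mul0r mulr0 subr0.
apply: (clone_kernel_avg_perm (z := ord_max)) => //; try exact: c0.
  move=> i i' j jmax; rewrite /clone_component.
  by case: unliftP jmax => [j' ->//|->]; rewrite eqxx.
have /eqP htt' : hist t == hist t' by rewrite -clP tt'.
apply/allP => j _ /=; rewrite -[_ == _]/(_ == _).
by have := congr1 (fun h => tnth h j) htt'; rewrite !tnth_mktuple => ->.
Qed.
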